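(* Let $f_1,\dots,f_k$ be homeomorphisms of the circle $S^1$. Then the following statements are equivalent: (1) the IFS generated by $f_1,\dots,f_k$ is renderable by the deterministic chaos game; (2) there exists $\omega\in\Omega=\{1,\dots,k\}^{\mathbb{N}}$ such that $\overline{O^+_\omega(x)}=S^1$ for all $x\in S^1$; (3) the IFS generated by $f_1,\dots,f_k$ is forward and backward minimal.
   Context: $\Gamma$ is the semigroup generated by $f_1,\dots,f_k$ (all compositions of one or more generators). The IFS is forward minimal if the only non-empty closed set $B\subset S^1$ with $g(B)\subset B$ for all $g\in\Gamma$ is $B=S^1$; it is backward minimal if the only non-empty closed set $B\subset S^1$ with $\emptyset\neq g^{-1}(B)\subset B$ for all $g\in\Gamma$ is $B=S^1$. For $\omega\in\Omega$, $f^n_\omega=f_{\omega_n}\circ\cdots\circ f_{\omega_1}$ and $O^+_\omega(x)=\{f^n_\omega(x):n\in\mathbb{N}\}$. $\mathbb{P}$ is any fixed Borel probability on $\Omega$ for which there is $0<p\le1/k$ with $\mathbb{P}(\omega_n=i\mid\omega_{n-1},\dots,\omega_1)\ge p$ for all $i\in\{1,\dots,k\}$, $n\in\mathbb{N}$. The IFS on $S^1$ is renderable by the deterministic chaos game if there is $\Omega_0\subset\Omega$ with $\mathbb{P}(\Omega_0)=1$ such that $\overline{O^+_\omega(x)}=S^1$ for all $\omega\in\Omega_0$ and $x\in S^1$ (in particular such an IFS is forward minimal). *)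

(* Defs.v *)
From HB Require Import structures.
From mathcomp Require Import all_boot all_order all_algebra.
From mathcomp Require Import all_classical all_reals all_analysis.
Set Implicit Arguments.
Unset Strict Implicit.
Unset Printing Implicit Defensive.
Import Order.TTheory GRing.Theory Num.Theory.
Import numFieldNormedType.Exports.
Local Open Scope classical_set_scope.
Local Open Scope ring_scope.

(* As a type, [circle R] is a [set_type], which carries the topology induced
   from the plane R * R. *)
Definition circle (R : realType) : set (R * R) :=
  [set z | z.1 ^+ 2 + z.2 ^+ 2 = 1].
Arguments circle R : clear implicits.

Definition homeomorphism (X Y : topologicalType) (f : X -> Y) : Prop :=
  continuous f /\
  exists g : Y -> X, [/\ continuous g, cancel f g & cancel g f].

Section IFS.
Context {I : Type} {X : topologicalType}.
Implicit Types (f : I -> X -> X) (B : set X) (omega : nat -> I).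

(* No identity is added: all elements are compositions of one or more f i. *)
Inductive semigroup_gen f : (X -> X) -> Prop :=
| semigroup_gen1 i : semigroup_gen f (f i)
| semigroup_genM g h :
    semigroup_gen f g -> semigroup_gen f h -> semigroup_gen f (g \o h).

Definition forward_minimal f : Prop :=
  forall B, closed B -> B !=set0 ->
    (forall g, semigroup_gen f g -> g @` B `<=` B) -> B = setT.

Definition backward_minimal f : Prop :=
  forall B, closed B -> B !=set0 ->
    (forall g, semigroup_gen f g -> g @^-1` B !=set0 /\ g @^-1` B `<=` B) ->
    B = setT.

(* Sequences are indexed from 0: the letter omega_n of the usual 1-based
   notation is [omega n.-1], so that
   [fiber_iter f omega n] = f_{omega_n} o ... o f_{omega_1}. *)
Fixpoint fiber_iter f omega (n : nat) : X -> X :=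
  if n is m.+1 then f (omega m) \o fiber_iter f omega m else id.

Definition fiber_orbit f omega (x : X) : set X :=
  [set fiber_iter f omega n x | n in [set n | (0 < n)%N]].

End IFS.

(* The measurable structure below is only available on pointed types, which is
   why alphabets are written 'I_k.+1: a family indexed by 'I_k.+1 is a family
   of k + 1 >= 1 maps. *)
HB.instance Definition _ (k : nat) := isPointed.Build 'I_k.+1 ord0.

Definition code_space (k : nat) :=
  prod_topology (fun _ : nat => discrete_topology 'I_k.+1).

Definition borel_code_space (k : nat) :=
  g_sigma_algebraType (@open (code_space k)).

Definition cylinder (k : nat) (tau : code_space k) (n : nat) :
    set (code_space k) :=
  [set omega | forall j, (j < n)%N -> omega j = tau j].

Section Probability.
Context {R : realType} {k : nat}.
Implicit Types P : probability (borel_code_space k) R.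

Definition cond_prob P (A C : set (borel_code_space k)) : R :=
  fine (P (A `&` C)) / fine (P C).

(* The past of a letter takes finitely many values, so conditioning on it is
   elementary conditioning on each cylinder of positive probability. *)
Definition bounded_below P : Prop :=
  exists p : R, [/\ 0 < p, p <= k.+1%:R^-1 &
    forall (n : nat) (i : 'I_k.+1) (tau : code_space k),
      (0 < P (cylinder tau n))%E ->
      p <= cond_prob P [set omega | omega n = i] (cylinder tau n)].

Definition renderable (X : topologicalType) P (f : 'I_k.+1 -> X -> X) : Prop :=
  exists Omega0 : set (borel_code_space k),
    [/\ measurable Omega0, P Omega0 = 1%E &
      forall omega, Omega0 omega ->
        forall x : X, closure (fiber_orbit f omega x) = setT].

End Probability.

(* Main.v *)
(** The implication from forward and backward minimality to the chaos game
    reduces to a finite statement: for every nonempty open U there is a finite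
    word w such that every point of the circle visits U while w is being
    applied. Almost every sequence contains all finite words, since a given
    word is missed m times in a row with probability at most (1 - p^|w|)^m.

    To find w, call K evasive if for every word some point of K avoids U along
    it, and suppose that the circle is evasive. Images of evasive sets are
    evasive, and if a finite union is evasive then some image of one of its
    pieces is. By forward minimality every point has an open neighbourhood that
    is not evasive; these can be taken with finite boundaries, finitely many of
    them suffice, and a connected evasive set must meet one of their boundaries,
    so that pairwise disjoint connected evasive sets are bounded in number. By
    backward minimality the images of any nonempty open V cover the circle;
    cutting the circle into arcs subordinate to that cover, some image of V
    contains a connected evasive set. Applying this to half of an open set V
    disjoint from n connected evasive sets gives n + 1 of them and a new V, a
    contradiction for n large. *)

Require Import Defs.
From mathcomp Require Import all_boot all_order all_algebra.
From mathcomp Require Import all_classical all_reals all_analysis.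
From mathcomp Require Import ring lra.
Set Implicit Arguments.
Unset Strict Implicit.
Unset Printing Implicit Defensive.
Import Order.TTheory GRing.Theory Num.Theory.
Import numFieldNormedType.Exports.
Local Open Scope classical_set_scope.
Local Open Scope ring_scope.

(** * Evasive sets *)

Section Words.
Context {J : Type} {X : topologicalType} (f : J -> X -> X).
Implicit Types (U K V : set X) (w v : seq J) (x : X).

Definition run w x : X := foldl (fun y i => f i y) x w.

(** The starting point is not tested: visits to [U] count only once a letter has been applied, just
    as [fiber_orbit] excludes time 0. *)
Fixpoint avoids U w x : Prop :=
  if w is i :: v then ~ U (f i x) /\ avoids U v (f i x) else True.

(** The empty word forces evasive sets to be nonempty. *)
Definition evasive U K : Prop := forall w, exists2 x, K x & avoids U w x.

Lemma run_cat w v x : run (w ++ v) x = run v (run w x).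
Proof. by rewrite /run foldl_cat. Qed.

Lemma avoids_cat U w v x :
  avoids U (w ++ v) x <-> avoids U w x /\ avoids U v (run w x).
Proof.
elim: w x => [|i w IH] x /=; first by split=> [|[]].
by rewrite IH; split=> [[? []]|[[]]].
Qed.

Lemma semigroup_gen_run g :
  semigroup_gen f g -> exists w, forall x, g x = run w x.
Proof.
elim=> [i|{}g h _ [w gw] _ [v hv]]; first by exists [:: i].
by exists (v ++ w) => x; rewrite run_cat -hv -gw.
Qed.

Lemma evasive_sub U K L : K `<=` L -> evasive U K -> evasive U L.
Proof.
by move=> KL Kev w; have [x Kx xw] := Kev w; exists x => //; exact: KL.
Qed.

Lemma evasive_run U K w : evasive U K -> evasive U (run w @` K).
Proof.
move=> Kev v; have [x Kx /avoids_cat[_ xv]] := Kev (w ++ v).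
by exists (run w x) => //; exists x.
Qed.

Lemma not_evasiveP U K :
  ~ evasive U K -> exists w, forall x, K x -> ~ avoids U w x.
Proof.
move=> /existsNP[w Kw]; exists w => x Kx xw; apply: Kw; by exists x.
Qed.

(* Otherwise the pieces could be captured one after the other by concatenating
   words. *)
Lemma evasive_piece U (C : nat -> set X) n :
  evasive U (\bigcup_(i < n) C i) ->
  exists2 i, (i < n)%N & exists w, evasive U (run w @` C i).
Proof.
apply: contraPP => noC; suff [w sw] : exists w, forall i, (i < n)%N ->
    forall x, C i x -> ~ avoids U w x.
  by move=> /(_ w)[x [i /= ilt Cx]]; exact: sw ilt _ Cx.
elim: n noC => [|n IH] noC; first by exists [::].
have [|w sw] := IH.
  by move=> [i ilt iw]; apply: noC; exists i => //; exact: ltnW.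
(* The earlier pieces already meet [U] along [w], so [v] has to capture only the image of the last
   piece under [w]; this is why images occur in the conclusion. *)
have [|v cv] := @not_evasiveP U (run w @` C n).
  by move=> nw; apply: noC; exists n => //; exists w.
exists (w ++ v) => i; rewrite ltnS leq_eqVlt => /orP[/eqP->|ilt] x Cx.
  by move=> /avoids_cat[_]; apply: cv; exists x.
by move=> /avoids_cat[xw _]; exact: sw ilt _ Cx xw.
Qed.

Lemma avoids_run U i w x : avoids U (i :: w) x -> ~ U (run (i :: w) x).
Proof. by elim: w i x => [|j w IH] i x /= []// _; exact: IH. Qed.

End Words.

Section Homeomorphisms.
Context {X Y Z : topologicalType}.

Lemma homeomorphism_comp (g : Y -> Z) (h : X -> Y) :
  homeomorphism g -> homeomorphism h -> homeomorphism (g \o h).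
Proof.
move=> [cg [g' [cg' gK g'K]]] [ch [h' [ch' hK h'K]]]; split.
  by move=> x; apply: continuous_comp; [exact: ch|exact: cg].
exists (h' \o g'); split; first by
  move=> x; apply: continuous_comp; [exact: cg'|exact: ch'].
- exact: can_comp.
- exact: can_comp.
Qed.

Lemma homeomorphism_open (h : X -> Y) (V : set X) :
  homeomorphism h -> open V -> open (h @` V).
Proof.
move=> [_ [g [cg hK gK]]] Vo; rewrite (_ : h @` V = g @^-1` V).
  by apply: open_comp => // y _; exact: cg.
apply/seteqP; split=> [_ [x Vx <-]|y Vgy] /=; first by rewrite hK.
by exists (g y).
Qed.

Lemma homeomorphism_surj (h : X -> Y) y : homeomorphism h -> exists x, h x = y.
Proof. by move=> [_ [g [_ _ gK]]]; exists (g y). Qed.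

Lemma homeomorphism_inj (h : X -> Y) : homeomorphism h -> injective h.
Proof. by move=> [_ [g [_ hK _]]]; exact: can_inj hK. Qed.

End Homeomorphisms.

(** * Reaching open sets under the two kinds of minimality *)

Section MinimalIFS.
Context {J : Type} {X : topologicalType} (f : J -> X -> X).
Hypothesis f_homeo : forall i, homeomorphism (f i).
Implicit Types (U K V : set X) (w v : seq J) (x : X).

Lemma run_homeo w : homeomorphism (run f w).
Proof.
elim: w => [|i w IH].
  by split; [|exists id; split] => // x; exact: cvg_id.
exact: homeomorphism_comp IH (f_homeo i).
Qed.

(** The points that no word sends into [U] form a closed forward invariant set, and the empty word
    shows that it misses [U]. *)
Lemma forward_minimal_reach U x :
  forward_minimal f -> open U -> U !=set0 -> exists w, U (run f w x).
Proof.
move=> fmin Uo [u Uu].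
pose B := [set y | forall w, ~ U (run f w y)].
have [nB|] := pselect (exists w, U (run f w x)); first by [].
move=> /forallNP xB; suff /seteqP[_ /(_ u I)/(_ [::])] : B = setT by [].
apply: fmin.
- rewrite (_ : B = \bigcap_(w in setT) ~` (run f w @^-1` U)).
    apply: closed_bigI => w _; apply: open_closedC; apply: open_comp => // y _.
    exact: (run_homeo w).1.
  by apply/seteqP; split=> [y By w _|y By w]; [exact: By|exact: By w Logic.I].
- by exists x.
- move=> g /semigroup_gen_run[w gw] _ [y By <-] v.
  by rewrite gw -run_cat; exact: By.
Qed.

(** The points outside all images of [V] form a closed set that contains its preimages: were [y] in
    an image of [V], so would be [g y]. Surjectivity makes these preimages nonempty. *)
Lemma backward_minimal_reach V x :
  backward_minimal f -> open V -> V !=set0 -> exists w, (run f w @` V) x.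
Proof.
move=> bmin Vo [v0 Vv0].
pose B := [set y | forall w, ~ (run f w @` V) y].
have [nB|] := pselect (exists w, (run f w @` V) x); first by [].
move=> /forallNP xB; suff /seteqP[_ /(_ v0 I)/(_ [::])] : B = setT.
  by case; exists v0.
apply: bmin.
- rewrite (_ : B = \bigcap_(w in setT) ~` (run f w @` V)).
    apply: closed_bigI => w _; apply: open_closedC.
    exact: homeomorphism_open (run_homeo w) Vo.
  by apply/seteqP; split=> [y By w _|y By w]; [exact: By|exact: By w Logic.I].
- by exists x.
- move=> g /semigroup_gen_run[w gw]; split.
    have [y wy] := homeomorphism_surj x (run_homeo w).
    by exists y; rewrite /= gw wy.
  move=> y /= By v [z Vz zy]; apply: (By (v ++ w)); exists z => //.
  by rewrite run_cat zy gw.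
Qed.

End MinimalIFS.

(** * Connected sets against finitely many boundary points *)

Section Capture.
Context {X : topologicalType}.
Implicit Types (U V W C : set X) (x : X).

(** The trace of [W] on [C] is also that of [closure W], hence clopen in [C]. *)
Lemma connected_sub_open C W : connected C -> open W -> C `&` W !=set0 ->
  C `&` (closure W `\` W) = set0 -> C `<=` W.
Proof.
move=> Cc Wo CW C0; rewrite setIC in CW *; suff <- : W `&` C = C by exact: subIsetl.
apply: Cc => //; first by exists W => //; rewrite setIC.
exists (closure W); first exact: closed_closure.
apply/seteqP; split=> x [] => [Wx Cx|Cx cWx].
  by split=> //; exact: subset_closure.
split=> //; have [//|nWx] := pselect (W x).
by suff : set0 x by []; rewrite -C0.
Qed.

Definition finite_boundary_base : Prop := forall U x, open U -> U x ->
  exists W, [/\ open W, W x, W `<=` U & finite_set (closure W `\` W)].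

(** The bound [i < n] stands under the existential so that [choice] yields a function on all of
    [nat]. *)
Definition connected_fragments : Prop :=
  forall D : X -> set X, (forall x, open (D x) /\ D x x) ->
  exists (n : nat) (C : nat -> set X), [set: X] `<=` \bigcup_(i < n) C i /\
    forall i, exists x, (i < n)%N -> connected (C i) /\ C i `<=` D x.

(** This holds in every Hausdorff space without isolated points. *)
Definition open_splitting : Prop := forall V, open V -> V !=set0 ->
  exists V1 V2, [/\ open V1 /\ open V2, V1 !=set0 /\ V2 !=set0,
    V1 `<=` V /\ V2 `<=` V & V1 `&` V2 = set0].

(** [F] collects the boundary points of finitely many sets [W (c i)] that cover the space. A
    connected set that meets one of these and misses its boundary lies inside it, hence inside some
    [D x]. *)
Lemma finite_barrier (D : X -> set X) :
  connected_fragments -> finite_boundary_base ->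
  (forall x, open (D x) /\ D x x) ->
  exists F : seq X, forall C, connected C -> C !=set0 ->
    (forall x, ~ C `<=` D x) -> exists2 p, p \in F & C p.
Proof.
move=> Xf Xb Dx.
have /choice[W Wx] x : exists W,
    [/\ open W, W x, W `<=` D x & finite_set (closure W `\` W)].
  by apply: Xb; have [] := Dx x.
have [|n [C [nC /choice[c cP]]]] := Xf W.
  by move=> x; have [] := Wx x.
have /finite_seqP[F FE] :
    finite_set (\bigcup_(i < n) (closure (W (c i)) `\` W (c i))).
  by apply: bigcup_finite => // i _; have [] := Wx (c i).
exists F => K Kc [y Ky] KD; have [i ilt Ciy] := nC y Logic.I.
have [Wo _ WD _] := Wx (c i); apply: contrapT => KF; apply: (KD (c i)).
apply: subset_trans WD; apply: connected_sub_open => //.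
  by exists y; split=> //; exact: (cP i ilt).2.
apply/seteqP; split=> // p [Kp bp]; apply: KF; exists p => //.
by have : [set` F] p by rewrite -FE; exists i.
Qed.

End Capture.
Arguments finite_boundary_base : clear implicits.
Arguments connected_fragments : clear implicits.
Arguments open_splitting : clear implicits.

(** * A single word that captures every point *)

Section CapturingWord.
Context {J : Type} {X : topologicalType} (f : J -> X -> X) (j0 : J).
Hypothesis f_homeo : forall i, homeomorphism (f i).
Hypothesis f_fwd : forward_minimal f.
Hypothesis f_bwd : backward_minimal f.
Hypothesis X_base : finite_boundary_base X.
Hypothesis X_frag : connected_fragments X.
Hypothesis X_split : open_splitting X.
Implicit Types (U V C : set X) (w : seq J) (x : X).

(** A set inside [D x] is sent into [U] by one fixed word, so no evasive set is contained in any
    [D x]. *)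
Lemma evasive_barrier U : open U -> U !=set0 ->
  exists F : seq X, forall C, connected C -> evasive f U C ->
    exists2 p, p \in F & C p.
Proof.
move=> Uo U0.
(* Reaching [U] from [f j0 x] makes the word [j0 :: w x] nonempty, so that its endpoint is among the
   tested points. *)
have /choice[w wU] x : exists w, U (run f w (f j0 x)).
  exact: forward_minimal_reach.
pose D x := run f (j0 :: w x) @^-1` U.
have Dx x : open (D x) /\ D x x.
  split; last exact: wU.
  by apply: open_comp => // y _; exact: (run_homeo f_homeo _).1.
have [F FP] := finite_barrier X_frag X_base Dx.
exists F => C Cc Ce; apply: FP => // [|x CD].
  by have [x Cx _] := Ce [::]; exists x.
by have [y Cy yw] := Ce (j0 :: w x); exact: avoids_run yw (CD y Cy).
Qed.

(** The fragments are subordinate to the cover by images of [V]. One of them has an evasive image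
    under some [v], and that image is still connected and still inside an image of [V]. *)
Lemma evasive_in_open U V : evasive f U setT -> open V -> V !=set0 ->
  exists w C, [/\ connected C, evasive f U C & C `<=` run f w @` V].
Proof.
move=> Te Vo V0.
have /choice[w wV] x : exists w, (run f w @` V) x.
  exact: backward_minimal_reach.
have [|n [C [nC CP]]] := @X_frag (fun x => run f (w x) @` V).
  by move=> x; split=> //; exact: homeomorphism_open (run_homeo f_homeo _) Vo.
have [i ilt [v ve]] := evasive_piece (evasive_sub nC Te).
have [x CDx] := CP i; have [Cc Cx] := CDx ilt.
exists (w x ++ v), (run f v @` C i); split=> //.
  apply: connected_continuous_connected => //; apply: continuous_subspaceT.
  exact: (run_homeo f_homeo _).1.
by move=> _ [y /Cx[z Vz <-] <-]; exists z => //; rewrite run_cat.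
Qed.

(* An image of one half V1 of V yields the additional set, and the image of the
   other half V2 is the new open set. *)
Lemma evasive_family U n : evasive f U setT ->
  exists V (B : nat -> set X), [/\ open V, V !=set0,
    forall i, (i < n)%N ->
      [/\ connected (B i), evasive f U (B i) & B i `&` V = set0] &
    forall i j, (i < j < n)%N -> B i `&` B j = set0].
Proof.
move=> Te; elim: n => [|n [V [B [Vo V0 BP BB]]]].
  exists setT, (fun=> set0); split=> //; first exact: openT.
  - by have [x _ _] := Te [::]; exists x.
  - by move=> i j; rewrite ltn0 andbF.
have [V1 [V2 [[V1o V2o] [V10 [z V2z]] [V1V V2V] V12]]] := X_split Vo V0.
have [w [C [Cc Ce CV1]]] := evasive_in_open Te V1o V10.
have winj := homeomorphism_inj (run_homeo f_homeo w).
(* By injectivity, disjointness from [V1] passes to images. As [C] lies in the image of [V1], it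
   misses the image of [V2] and those of the old sets. *)
have disj K L : K `&` L = set0 -> run f w @` K `&` run f w @` L = set0.
  move=> KL; apply/seteqP; split=> // _ [[x Kx <-] [y Ly /winj yx]].
  by suff : set0 x by []; rewrite -KL; split=> //; rewrite -yx.
exists (run f w @` V2), (fun i => if i == n then C else run f w @` B i); split.
- exact: homeomorphism_open (run_homeo f_homeo _) V2o.
- by exists (run f w z), z.
- move=> i; rewrite ltnS leq_eqVlt; case: eqP => [_ _|_ /= ilt].
    split=> //; apply: subsetI_eq0 (disj _ _ V12) => //.
  have [Bc Be BV] := BP i ilt; split.
  + apply: connected_continuous_connected => //; apply: continuous_subspaceT.
    exact: (run_homeo f_homeo _).1.
  + exact: evasive_run.
  + by apply: disj; apply: subsetI_eq0 BV.
- move=> i j /andP[ij]; rewrite ltnS leq_eqVlt => /orP[/eqP jn|jn].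
    have ilt : (i < n)%N by rewrite -jn.
    rewrite jn eqxx ltn_eqF//; have [_ _ BV] := BP i ilt.
    have /disj BV1 : B i `&` V1 = set0 by exact: subsetI_eq0 BV.
    exact: subsetI_eq0 BV1.
  rewrite !ltn_eqF//; last exact: ltn_trans jn.
  by apply/disj/BB; rewrite ij.
Qed.

Theorem capturing_word U : open U -> U !=set0 ->
  exists w, forall x, ~ avoids f U w x.
Proof.
move=> Uo U0; suff /not_evasiveP[w wP] : ~ evasive f U setT.
  by exists w => x; exact: wP.
move=> Te; have [F FP] := evasive_barrier Uo U0.
have [V [B [_ _ BP BB]]] := evasive_family (size F).+1 Te.
(* Out of range, any point serves as a value of [p]. *)
have /choice[p pP] i : exists x, (i < (size F).+1)%N -> x \in F /\ B i x.
  case: ltnP => [ilt|_]; last by have [x _ _] := Te [::]; exists x.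
  by have [Bc Be _] := BP i ilt; have [x xF Bx] := FP _ Bc Be; exists x.
(* Pigeonhole: the sets are pairwise disjoint, so the chosen points of [F] are distinct, one more
   than [F] can hold. *)
have : (size (mkseq p (size F).+1) <= size F)%N.
  apply: uniq_leq_size.
    apply/mkseq_uniqP => i j; rewrite !inE => ilt jlt pij.
    have [iF Bi] := pP i ilt; have [jF Bj] := pP j jlt.
    case: (ltngtP i j) => // ij; exfalso.
      by suff : set0 (p i) by []; rewrite -(BB i j) ?ij//; split=> //; rewrite pij.
    by suff : set0 (p i) by []; rewrite -(BB j i) ?ij//; split=> //; rewrite pij.
  by move=> _ /mapP[i ilt ->]; apply: (pP i _).1; rewrite mem_iota in ilt.
by rewrite size_mkseq ltnn.
Qed.

End CapturingWord.

(** * Topology of the circle *)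

Section Circle.
Context {R : realType}.
Implicit Types (t c : R) (U V : set (circle R)) (z : circle R).

Lemma circle_angle_subproof t : (cos t, sin t) \in circle R.
Proof. by apply/mem_set; rewrite /circle /= cos2Dsin2. Qed.

Definition circle_angle t : circle R :=
  exist (fun q => q \in circle R) (cos t, sin t) (circle_angle_subproof t).

Lemma circle_eq z : (\val z).1 ^+ 2 + (\val z).2 ^+ 2 = 1.
Proof. by case: z => z /= /set_mem. Qed.

Lemma circle_val_continuous : continuous (\val : circle R -> R * R).
Proof. exact: initial_continuous. Qed.

Lemma circle_angle_continuous : continuous circle_angle.
Proof.
apply: (@continuous_comp_initial (circle R) R (R * R)%type \val circle_angle).
move=> t; apply: (@cvg_pair R R R (nbhs t) (nbhs (cos t)) (nbhs (sin t))).
  exact: continuous_cos.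
exact: continuous_sin.
Qed.

Lemma coord_bound a b : a ^+ 2 + b ^+ 2 = 1 :> R ->
  -1 <= a <= 1 /\ (b = Num.sqrt (1 - a ^+ 2) \/ b = - Num.sqrt (1 - a ^+ 2)).
Proof.
move=> ab; have b2 : 0 <= 1 - a ^+ 2 by rewrite -ab addrC addKr sqr_ge0.
split; first by nra.
have /eqP : b ^+ 2 = Num.sqrt (1 - a ^+ 2) ^+ 2 by rewrite sqr_sqrtr//; lra.
by rewrite eqf_sqr => /orP[]/eqP; [left|right].
Qed.

Lemma circle_angle_surj z : exists2 t, t \in `[- pi, pi] & circle_angle t = z.
Proof.
have [a1 bE] := coord_bound (circle_eq z).
have s0 := acos_ge0 a1; have sp := acos_lepi a1.
have p0 : 0 <= pi :> R := pi_ge0 R.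
have cK : cos (acos (\val z).1) = (\val z).1 by apply: acosK; rewrite in_itv.
case: bE => bE.
- exists (acos (\val z).1); first by rewrite in_itv /=; apply/andP; split; lra.
  by apply/val_inj; rewrite /= cK sin_acos// -bE -surjective_pairing.
- exists (- acos (\val z).1); first by rewrite in_itv /=; apply/andP; split; lra.
  by apply/val_inj; rewrite /= cosN cK sinN sin_acos// -bE -surjective_pairing.
Qed.

Lemma circle_compact : compact [set: circle R].
Proof.
rewrite (_ : setT = circle_angle @` `[- pi, pi]%classic).
  apply: continuous_compact; last exact: segment_compact.
  exact/continuous_subspaceT/circle_angle_continuous.
apply/seteqP; split=> // z _; have [t tp tz] := circle_angle_surj z.
by exists t.
Qed.

(** The cover is pulled back to angles: finitely many intervals cover [[- pi, pi]], and their images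
    are connected arcs. *)
Lemma circle_fragments : connected_fragments (circle R).
Proof.
move=> D Dz.
have /choice[e eD] t : exists e : R, 0 < e /\
    ball t e `<=` circle_angle @^-1` D (circle_angle t).
  have [Do Dt] := Dz (circle_angle t).
  have : nbhs t (circle_angle @^-1` D (circle_angle t)).
    by apply: circle_angle_continuous; exact: open_nbhs_nbhs.
  by move=> /nbhs_ballP[e /= e0 eD]; exists e.
have := @segment_compact R (- pi) pi; rewrite compact_cover.
move=> /(_ _ setT (fun t => ball t (e t)))[].
- by move=> t _; exact: ball_open.
- by move=> t _; exists t => //; apply: ballxx; exact: (eD t).1.
move=> D' _; pose s : seq R := finmap.enum_fset D' => sC.
pose C i := circle_angle @` ball (nth 0 s i) (e (nth 0 s i)).
exists (size s), C; split.
  move=> z _; have [t /= tp <-] := circle_angle_surj z.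
  have [r /= rs rt] := sC t tp; exists (index r s); first by rewrite /= index_mem.
  by exists t => //; rewrite nth_index.
move=> i; exists (circle_angle (nth 0 s i)) => _; split.
  apply: connected_continuous_connected; last first.
    exact/continuous_subspaceT/circle_angle_continuous.
  apply/connected_intervalP => x y; rewrite /ball /= => xb yb w /andP[xw wy].
  move: xb yb; rewrite !ltr_distlC => /andP[? ?] /andP[? ?].
  by apply/andP; split; lra.
by move=> _ [t rt <-]; exact: (eD _).2.
Qed.

Lemma circle_fst_finite c : finite_set [set z : circle R | (\val z).1 = c].
Proof.
pose b := Num.sqrt (1 - c ^+ 2).
apply: (@sub_finite_set _ _ (\val @^-1` [set (c, b); (c, - b)])).
  move=> z /= zc; have [_] := coord_bound (circle_eq z).
  by rewrite zc => -[]; rewrite -/b => <-; [left|right];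
    rewrite -zc -surjective_pairing.
apply: finite_preimage; last exact: finite_set2.
by move=> x y _ _; exact: val_inj.
Qed.

Lemma circle_snd_finite c : finite_set [set z : circle R | (\val z).2 = c].
Proof.
pose a := Num.sqrt (1 - c ^+ 2).
apply: (@sub_finite_set _ _ (\val @^-1` [set (a, c); (- a, c)])).
  move=> z /= zc; have := circle_eq z; rewrite addrC => /coord_bound[_].
  by rewrite zc => -[]; rewrite -/a => <-; [left|right];
    rewrite -zc -surjective_pairing.
apply: finite_preimage; last exact: finite_set2.
by move=> x y _ _; exact: val_inj.
Qed.

(** Balls of [R * R] are squares, so the boundary of the trace of one lies on four lines, each of
    which meets the circle in at most two points. *)
Lemma circle_base : finite_boundary_base (circle R).
Proof.
move=> U x Uo Ux; have [W Wo WU] := Uo.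
have : nbhs (\val x) W by apply: open_nbhs_nbhs; split=> //; rewrite -WU in Ux.
move=> /nbhs_ballP[e /= e0 eW].
pose B y d : set (circle R) := \val @^-1` ball (\val (y : circle R)) d.
have Bo y d : open (B y d).
  by apply: open_comp; [move=> z _; exact: circle_val_continuous|exact: ball_open].
exists (B x e); split=> //; [exact: ballxx|by rewrite -WU => z /eW|].
pose L := [set z : circle R | (\val z).1 = (\val x).1 - e] `|`
          [set z : circle R | (\val z).1 = (\val x).1 + e] `|`
          [set z : circle R | (\val z).2 = (\val x).2 - e] `|`
          [set z : circle R | (\val z).2 = (\val x).2 + e].
apply: (@sub_finite_set _ _ L); last first.
  rewrite !finite_setU; do !split;
    by [exact: circle_fst_finite|exact: circle_snd_finite].
move=> z [zB nzB].
(* As [z] is a limit of points of the open square, the strict bounds become weak ones. *)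
have le_dist : `|(\val x).1 - (\val z).1| <= e /\ `|(\val x).2 - (\val z).2| <= e.
  split; apply/ler_addgt0Pr => d d0;
    (have [|y [[xy1 xy2] [zy1 zy2]]] := zB (B z d);
      first by apply: open_nbhs_nbhs; split=> //; exact: ballxx);
    rewrite /ball /= in xy1 xy2 zy1 zy2.
  - apply: (le_trans (ler_distD (\val y).1 _ _)).
    by rewrite (distrC (\val y).1); apply/ltW/ltrD.
  - apply: (le_trans (ler_distD (\val y).2 _ _)).
    by rewrite (distrC (\val y).2); apply/ltW/ltrD.
have [lt1|ge1] := ltP `|(\val x).1 - (\val z).1| e; last first.
  do 2!left; have /eqP : `|(\val x).1 - (\val z).1| = e.
    by apply/le_anti; rewrite ge1 le_dist.1.
  by rewrite eqr_norml => /andP[/orP[]/eqP E _]; [left|right] => /=; lra.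
have [lt2|ge2] := ltP `|(\val x).2 - (\val z).2| e; last first.
  have /eqP : `|(\val x).2 - (\val z).2| = e.
    by apply/le_anti; rewrite ge2 le_dist.2.
  by rewrite eqr_norml => /andP[/orP[]/eqP E _]; [left; right|right] => /=; lra.
by case: nzB.
Qed.

Lemma circle_splitting : open_splitting (circle R).
Proof.
move=> V Vo [v Vv]; have [t _ tv] := circle_angle_surj v.
have : nbhs t (circle_angle @^-1` V).
  by apply: circle_angle_continuous; apply: open_nbhs_nbhs; rewrite tv.
move=> /nbhs_ballP[e /= e0 eV].
(* Rotation by [h] stays in [V] because [h < e], and it moves the point because [0 < h <= pi], where
   [cos] is injective. *)
pose h : R := Num.min (e / 2) (pi / 2).
have p0 : 0 < pi :> R := pi_gt0 R.
have h0 : 0 < h by rewrite lt_min; apply/andP; split; lra.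
have he : h < e by rewrite gt_min; apply/orP; left; lra.
have hp : h <= pi by rewrite ge_min; apply/orP; right; lra.
have Vth : V (circle_angle (t + h)).
  by apply: eV; rewrite /ball /= opprD addNKr normrN gtr0_norm.
have neq : \val v != \val (circle_angle (t + h)).
  apply/negP => /eqP; rewrite -tv /= => -[ct st].
  (* Expand the cosine of the difference of [t + h] and [t]. *)
  have : cos h = cos 0.
    rewrite cos0 -(cos2Dsin2 t) -{1}(addKr t h) addrC cosB -ct -st; ring.
  move=> /cos_inj h_eq; suff hE : h = 0 by rewrite hE ltxx in h0.
  by apply: h_eq; rewrite in_itv /=; apply/andP; split=> //; lra.
have := @norm_hausdorff _ (R * R)%type; rewrite open_hausdorff => /(_ _ _ neq).
move=> [[A B] /= [/set_mem Av /set_mem Bt] [Ao Bo /eqP AB]].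
exists (V `&` \val @^-1` A), (V `&` \val @^-1` B); split.
- by split; apply: openI => //; apply: open_comp => // z _;
    exact: circle_val_continuous.
- by split; [exists v|exists (circle_angle (t + h))].
- by split; exact: subIsetl.
- apply/seteqP; split=> // z [[_ Az] [_ Bz]].
  by suff : set0 (\val z) by []; rewrite -AB.
Qed.

End Circle.

(** * Random words *)

Section InfiniteWords.
Context {R : realType} {k : nat}.
Variable P : probability (borel_code_space k) R.
Local Notation T := (borel_code_space k).
Implicit Types (omega tau : code_space k) (w : seq 'I_k.+1) (n m : nat).

Fixpoint follows w n omega : Prop :=
  if w is i :: v then omega n = i /\ follows v n.+1 omega else True.

Lemma follows_prefix w n omega tau :
  (forall j, (j < n + size w)%N -> omega j = tau j) ->
  follows w n omega -> follows w n tau.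
Proof.
elim: w n => //= i w IH n ot [oi ow]; split.
  by rewrite -ot// addnS ltnS leq_addr.
by apply: IH ow => j; rewrite addSnnS; exact: ot.
Qed.

Lemma measurable_letter n (i : 'I_k.+1) : measurable [set omega : T | omega n = i].
Proof.
apply: sub_sigma_algebra.
have -> : [set omega : T | omega n = i] =
    @proj nat (fun=> discrete_topology 'I_k.+1) n @^-1` [set i] by [].
apply: open_comp; last exact: discrete_open.
by move=> omega _; exact: proj_continuous.
Qed.

Lemma measurable_cylinder tau n : measurable (cylinder tau n : set T).
Proof.
elim: n => [|n IH].
  by rewrite (_ : cylinder tau 0 = setT)//; apply/seteqP; split.
rewrite (_ : cylinder tau n.+1 = cylinder tau n `&` [set omega | omega n = tau n]).
  exact: measurableI IH (measurable_letter _ _).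
apply/seteqP; split=> [omega on|omega [on ot] j].
  by split; [move=> j jn; apply: on; exact: ltnW|exact: on].
by rewrite ltnS leq_eqVlt => /orP[/eqP->//|]; exact: on.
Qed.

Lemma measurable_follows w n : measurable ([set omega | follows w n omega] : set T).
Proof.
elim: w n => [|i w IH] n /=; first exact: measurableT.
exact: (measurableI _ _ (measurable_letter n i) (IH n.+1)).
Qed.

(** * Probability that a block occurs, given the past *)

Section LowerBound.
Variable p : R.
Hypothesis p_gt0 : 0 < p.
Hypothesis p_le1 : p <= 1.
Hypothesis p_cond : forall n i tau, (0 < P (cylinder tau n))%E ->
  p <= cond_prob P [set omega | omega n = i] (cylinder tau n).

Let fineP_K (A : set T) : measurable A -> (fine (P A))%:E = P A.
Proof. by move=> mA; rewrite fineK// fin_num_measure. Qed.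

Lemma cylinder_letter n i tau :
  p * fine (P (cylinder tau n)) <=
  fine (P (cylinder tau n `&` [set omega | omega n = i])).
Proof.
have mC := measurable_cylinder tau n.
(* The hypothesis on conditional probabilities says nothing about null cylinders, but there the left
   side is 0. *)
have [P0|] := leP (P (cylinder tau n)) 0.
  have -> : P (cylinder tau n) = 0%E by apply/le_anti; rewrite P0 measure_ge0.
  by rewrite mulr0 fine_ge0.
move=> P0; have := p_cond i P0; rewrite /cond_prob setIC ler_pdivlMr//.
by apply: fine_gt0; rewrite P0 -ge0_fin_numE// fin_num_measure.
Qed.

Lemma cylinder_follows w n tau :
  p ^+ size w * fine (P (cylinder tau n)) <=
  fine (P (cylinder tau n `&` [set omega | follows w n omega])).
Proof.
elim: w n tau => [|i w IH] n tau.
  by rewrite mul1r (_ : [set _ | _] = setT) ?setIT//; apply/seteqP; split.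
(* Writing [i] at position [n] turns the event that the next letter is [i] into a longer cylinder,
   to which induction applies. *)
pose tau' : code_space k := fun j => if j == n then i else tau j.
have cylS : cylinder tau' n.+1 = cylinder tau n `&` [set omega | omega n = i].
  apply/seteqP; split=> [omega ot|omega [ot oi] j].
    split=> [j jn|]; last by rewrite /= ot// /tau' eqxx.
    by rewrite ot ?ltnS 1?ltnW// /tau' ltn_eqF.
  rewrite ltnS leq_eqVlt /tau'; case: eqP => [->//|_ /= jn]; exact: ot.
have -> : cylinder tau n `&` [set omega | follows (i :: w) n omega] =
    cylinder tau' n.+1 `&` [set omega | follows w n.+1 omega].
  by rewrite cylS -setIA.
apply: le_trans (IH n.+1 tau'); rewrite /= exprSr -mulrA cylS.
by apply: ler_wpM2l; [exact/exprn_ge0/ltW|exact: cylinder_letter].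
Qed.

(** Finite functions encode words of length [n]; the filler [ord0] from position [n] on is invisible
    to a cylinder of length [n]. *)
Let extend n (t : {ffun 'I_n -> 'I_k.+1}) : code_space k :=
  fun j => if insub j is Some i then t i else ord0.

Lemma cylinder_partition n (A : set T) : measurable A ->
  fine (P A) = \sum_(t : {ffun 'I_n -> 'I_k.+1})
    fine (P (A `&` cylinder (extend t) n)).
Proof.
move=> mA.
have extE (t : {ffun 'I_n -> 'I_k.+1}) (i : 'I_n) : extend t i = t i.
  by rewrite /extend valK.
have mC t : measurable (A `&` cylinder (extend t) n : set T).
  by apply: measurableI => //; exact: measurable_cylinder.
have AE : A =
    \bigcup_(t in [set: {ffun 'I_n -> 'I_k.+1}]) (A `&` cylinder (extend t) n).
  rewrite -setI_bigcupr; apply/esym/setIidPl => omega _.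
  exists [ffun i : 'I_n => omega i] => // j jn.
  by have := extE [ffun i : 'I_n => omega i] (Ordinal jn); rewrite ffunE => ->.
have -> : P A =
    (\sum_(t : {ffun 'I_n -> 'I_k.+1}) P (A `&` cylinder (extend t) n))%E.
  rewrite {1}AE measure_fin_bigcup//.
  - rewrite [RHS]fsbig_seq ?index_enum_uniq//; apply: eq_fsbigl.
    by apply/seteqP; split=> // t _ /=; rewrite mem_index_enum.
  - exact: finite_finset.
  - move=> t t' _ _ [omega [[_ ot] [_ ot']]]; apply/ffunP => i.
    by rewrite -!extE -ot// -ot'.
by rewrite sum_fine// => t _; exact: fin_num_measure.
Qed.

(** Each cylinder of length [n] lies in [S] or misses it, so the bound on cylinders can be
    summed. *)
Lemma determined_follows w n (S : set T) : measurable S ->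
  (forall omega tau, (forall j, (j < n)%N -> omega j = tau j) -> S omega -> S tau) ->
  p ^+ size w * fine (P S) <= fine (P (S `&` [set omega | follows w n omega])).
Proof.
move=> mS Sn; have mF := measurable_follows w n.
rewrite (cylinder_partition n mS) (cylinder_partition n (measurableI _ _ mS mF)).
rewrite mulr_sumr; apply: ler_sum => t _.
set tau := (X in cylinder X n).
have [Stau|nStau] := pselect (S tau).
  have SC : S `&` cylinder tau n = cylinder tau n.
    by apply/setIidPr => omega ot; apply: Sn Stau => j jn; rewrite ot.
  by rewrite setIAC SC; exact: cylinder_follows.
rewrite (_ : S `&` cylinder tau n = set0) ?measure0 ?mulr0 ?fine_ge0//.
apply/seteqP; split=> // omega [So ot]; apply: nStau; exact: Sn ot So.
Qed.

(** Only the disjoint blocks starting at multiples of [size w] are examined. Each is missed with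
    conditional probability at most [1 - p ^+ size w], so missing all of them has probability 0. *)
Lemma follows_ae w :
  P [set omega | forall n, ~ follows w n omega] = 0%E.
Proof.
pose A m : set T :=
  [set omega | forall l, (l < m)%N -> ~ follows w (l * size w)%N omega].
pose F m : set T := [set omega | follows w (m * size w)%N omega].
have AS m : A m.+1 = A m `\` F m.
  apply/seteqP; split=> [omega Ao|omega [Ao Fo] l].
    by split; [move=> l lm; apply: Ao; exact: ltnW|exact: Ao].
  by rewrite ltnS leq_eqVlt => /orP[/eqP->//|]; exact: Ao.
have mF m : measurable (F m) by exact: measurable_follows.
have mA m : measurable (A m).
  elim: m => [|m IH]; last by rewrite AS; exact: measurableD.
  by rewrite (_ : A 0 = setT)//; apply/seteqP; split.
have A_le m : fine (P (A m)) <= (1 - p ^+ size w) ^+ m.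
  elim: m => [|m IH].
    by rewrite expr0 -lee_fin fineP_K//; exact: probability_le1.
  (* [A m] depends only on the letters before position [m * size w], where the block of [F m]
     starts. *)
  have AF : p ^+ size w * fine (P (A m)) <= fine (P (A m `&` F m)).
    apply: determined_follows => // omega tau ot Ao l lm /follows_prefix wt.
    apply: (Ao l lm); apply: wt => j jl; rewrite ot//.
    by apply: leq_trans jl _; rewrite -mulSnr leq_mul2r lm orbT.
  rewrite AS measureD//; last by rewrite -ge0_fin_numE// fin_num_measure.
  rewrite fineB ?fin_num_measure//; last exact: measurableI.
  rewrite exprS; apply: le_trans (_ : (1 - p ^+ size w) * fine (P (A m)) <= _).
    by rewrite mulrBl mul1r lerB.
  by apply: ler_wpM2l => //; rewrite subr_ge0 exprn_ile1// ltW.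
pose N : set T := [set omega | forall n, ~ follows w n omega]; rewrite -/N.
have mN : measurable N.
  rewrite (_ : N = \bigcap_n ~` [set omega | follows w n omega]).
    apply: bigcapT_measurable => n; apply: measurableC.
    exact: measurable_follows.
  by apply/seteqP; split=> [omega No n _|omega No n]; exact: No.
have N_le m : fine (P N) <= (1 - p ^+ size w) ^+ m.
  apply: le_trans (A_le m); rewrite fine_le ?fin_num_measure//.
  by apply: le_measure; rewrite ?inE// => omega No l _; exact: No.
have q_lt1 : `|1 - p ^+ size w| < 1.
  rewrite ger0_norm ?subr_ge0 ?exprn_ile1// ?ltW//.
  by rewrite ltrBlDr ltrDl exprn_gt0.
rewrite -fineP_K//; congr EFin; apply/le_anti; rewrite fine_ge0 ?andbT//.
rewrite leNgt; apply/negP => N0.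
have := cvg_expr q_lt1; move=> /cvgr0Pnorm_lt/(_ _ N0)[m _ /(_ m (leqnn m))].
by rewrite ltNge (le_trans (N_le m)) ?ler_norm.
Qed.

End LowerBound.

Lemma all_words_ae : bounded_below P ->
  exists Omega0 : set T, [/\ measurable Omega0, P Omega0 = 1%E &
    forall omega, Omega0 omega -> forall w, exists n, follows w n omega].
Proof.
move=> [p [p0 pk p_cond]].
have p1 : p <= 1 by apply: le_trans pk _; rewrite invf_le1 ?ler1n.
pose N w : set T := [set omega | forall n, ~ follows w n omega].
have mN w : measurable (N w).
  rewrite (_ : N w = \bigcap_n ~` [set omega | follows w n omega]).
    apply: bigcapT_measurable => n; apply: measurableC.
    exact: measurable_follows.
  by apply/seteqP; split=> [omega No n _|omega No n]; exact: No.
(* There are countably many words; codes of no word contribute the empty set. *)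
pose B i : set T := if unpickle i is Some w then N w else set0.
have mB i : measurable (B i) by rewrite /B; case: unpickle.
have PB : P (\bigcup_i B i) = 0%E.
  apply/negligibleP; first exact: bigcupT_measurable.
  apply: negligible_bigcup => i; apply/negligibleP => //.
  rewrite /B; case: unpickle => [w|]; last exact: measure0.
  exact: follows_ae p_cond w.
have mU : measurable (\bigcup_i B i) by exact: bigcupT_measurable.
exists (~` \bigcup_i B i); split; first exact: measurableC.
  by rewrite probability_setC// PB sube0.
move=> omega noB w; apply: contrapT => /forallNP now; apply: noB.
by exists (pickle w) => //; rewrite /B pickleK.
Qed.

End InfiniteWords.

(** * Dense orbits and minimality *)

Section DenseOrbits.
Context {J : Type} {X : topologicalType} (f : J -> X -> X) (omega : nat -> J).
Hypothesis f_homeo : forall i, homeomorphism (f i).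
Hypothesis omega_dense : forall x, closure (fiber_orbit f omega x) = setT.
Implicit Types (B : set X) (n : nat).

Lemma semigroup_gen_fiber_iter n : semigroup_gen f (fiber_iter f omega n.+1).
Proof.
elim: n => [|n IH]; first exact: semigroup_gen1.
exact: semigroup_genM (semigroup_gen1 _ _) IH.
Qed.

Lemma fiber_iter_homeo n : homeomorphism (fiber_iter f omega n).
Proof.
elim: n => [|n IH]; last exact: homeomorphism_comp.
by split; [|exists id; split] => // x; exact: cvg_id.
Qed.

Lemma closed_dense_orbit B x : closed B ->
  (forall n, B (fiber_iter f omega n.+1 x)) -> B = setT.
Proof.
move=> Bc xB; apply/seteqP; split=> // y _; rewrite (closure_id B).1//.
suff : closure (fiber_orbit f omega x) y by apply: closure_subset => _ [[//|n] _ <-].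
by rewrite omega_dense.
Qed.

Lemma dense_forward_minimal : forward_minimal f.
Proof.
move=> B Bc [x Bx] fB; apply: closed_dense_orbit Bc _ => // n.
by apply: (fB _ (semigroup_gen_fiber_iter n)); exists x.
Qed.

(* The sets of points whose first n iterates along omega stay in B decrease
   with n, so by compactness some orbit stays in B forever. *)
Lemma dense_backward_minimal : compact [set: X] -> backward_minimal f.
Proof.
move=> Xc B Bc [b Bb] fB.
pose K n := fiber_iter f omega n @^-1` B.
have Kc n : closed (K n).
  by apply: preimage_closed => // x _; exact: (fiber_iter_homeo n).1.
(* One step back in time is the inclusion of the preimage of [B] under a generator in [B]. *)
have KS m n : (n <= m)%N -> K m `<=` K n.
  move=> /subnK <-; elim: (m - n)%N => // d IH x Kx; apply: IH.
  exact: (fB _ (semigroup_gen1 _ (omega (d + n)%N))).2.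
have /choice[u uK] n : exists x, K n x.
  have [x xb] := homeomorphism_surj b (fiber_iter_homeo n).
  by exists x; rewrite /K /= xb.
have [|x [_ xu]] := Xc (u @ \oo) _; first exact: filterT.
apply: (closed_dense_orbit (x := x)) => // n.
suff : closure (K n.+1) x by rewrite -(closure_id _).1.
(* The tail of [u] from index [n.+1] on lies in the closed set [K n.+1], hence so does the cluster
   point [x]. *)
move=> N Nx; apply: (xu (K n.+1) N _ Nx); exists n.+1 => // m /= nm.
exact: KS nm _ (uK m).
Qed.

End DenseOrbits.

(** Reading [w] from position [n] of [omega] reproduces the orbit at the times just after [n]. *)
Lemma follows_avoids (k : nat) (X : topologicalType) (f : 'I_k.+1 -> X -> X)
    (omega : code_space k) (U : set X) (w : seq 'I_k.+1) (n : nat) (x : X) :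
  follows w n omega -> (forall m, (n < m)%N -> ~ U (fiber_iter f omega m x)) ->
  avoids f U w (fiber_iter f omega n x).
Proof.
elim: w n => //= i w IH n [<- wn] nU; split; first exact: nU n.+1 _.
by apply: (IH n.+1) => // m nm; apply: nU; exact: ltnW.
Qed.

Theorem corollary1 (R : realType) (k : nat)
    (P : probability (borel_code_space k) R) (P_bounded : bounded_below P)
    (f : 'I_k.+1 -> circle R -> circle R)
    (f_homeo : forall i : 'I_k.+1, homeomorphism (f i)) :
  (renderable P f <->
   exists omega : code_space k,
     forall x : circle R, closure (fiber_orbit f omega x) = setT) /\
  ((exists omega : code_space k,
     forall x : circle R, closure (fiber_orbit f omega x) = setT) <->
   forward_minimal f /\ backward_minimal f).
Proof.
have renderable_dense : renderable P f -> exists omega : code_space k,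
    forall x : circle R, closure (fiber_orbit f omega x) = setT.
  move=> [E [_ P1 dense]].
  have [E0|/set0P/negP/negPn/eqP E0] := pselect (E !=set0).
    by have [omega oE] := E0; exists omega; exact: dense.
  by move: P1; rewrite E0 measure0 => /eqP; rewrite eq_sym onee_eq0.
have dense_minimal : (exists omega : code_space k,
    forall x : circle R, closure (fiber_orbit f omega x) = setT) ->
    forward_minimal f /\ backward_minimal f.
  move=> [omega dense]; split; first exact: dense_forward_minimal dense.
  exact: dense_backward_minimal f_homeo dense circle_compact.
(* This implication closes the cycle, which gives both equivalences. *)
suff minimal_renderable : forward_minimal f /\ backward_minimal f -> renderable P f.
  by split; split; auto.
move=> [fmin bmin]; have [E [mE PE words]] := all_words_ae P_bounded.
exists E; split=> // omega oE x; apply/seteqP; split=> // y _ N.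
rewrite nbhsE => -[U [Uo Uy] UN].
have [|w wU] := capturing_word ord0 f_homeo fmin bmin circle_base circle_fragments
  circle_splitting Uo; first by exists y.
have [n wn] := words omega oE w.
(* The word [w] captures every point, in particular wherever the orbit of [x] stands when [w]
   begins; the visit to [U] occurs at a positive time. *)
apply: contrapT => noU; apply: (wU (fiber_iter f omega n x)).
apply: follows_avoids wn _ => m nm Um; apply: noU.
exists (fiber_iter f omega m x); split; last exact: UN.
by exists m => //=; exact: leq_ltn_trans nm.
Qed.
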